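(* Let $A\in\mathbb C^{6\times 6}$ be a nilpotent rank three partial isometry, i.e. (a rank three partial isometry) circularly equivalent to a matrix $$M=\begin{bmatrix}0&0&0&1&0&0\\0&0&0&0&b&0\\0&0&0&0&c&e\\0&0&0&0&d&f\\0&0&0&0&0&g\\0&0&0&0&0&h\end{bmatrix}$$ with $h=0$, $b,c,d,e\ge0$, $f,g\in\mathbb C$, and $c=0$ whenever $e=0$. Then $C(A)$ contains a (non-trivial) circular component if and only if $ceg=0$. If this condition holds, then $C(A)$ consists of three concentric circles, $$C(A)=\mathcal C_{r_1}\cup\mathcal C_{r_2}\cup\mathcal C_{r_3},$$ one of which degenerates into $\{0\}$ if and only if $be=0$. Here $r_i=\sqrt{\rho_i}$, where $\rho_1\le\rho_2\le\rho_3$ are the roots of the polynomial $$\varphi(\rho)=\rho^3-\tfrac34\rho^2+\tfrac1{16}(b^2+c^2+e^2+1)\rho-\tfrac1{64}b^2e^2 .$$ In particular, $W(A)$ is then the circular disk bounded by $\mathcal C_{r_3}$.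
   Context: A matrix $A$ is a partial isometry if $\|Ax\|=\|x\|$ for all $x\perp\ker A$. Matrices $A$ and $B$ are circularly equivalent ($A\sim B$) if $B=e^{i\theta}UAU^*$ for some unitary $U$ and real $\theta$. $W(A)=\{\langle Ax,x\rangle:\|x\|=1\}$ is the numerical range. Put $\operatorname{Re}X=(X+X^* )/2$. The Kippenhahn polynomial of $A\in\mathbb C^{n\times n}$ is $P_A(\lambda,\theta)=\det(\operatorname{Re}(e^{i\theta}A)-\lambda I)$. With $\lambda_1(\theta),\dots,\lambda_n(\theta)$ its roots in $\lambda$, the Kippenhahn curve $C(A)$ is the envelope of the family of lines $\{e^{-i\theta}(\lambda_j(\theta)+i\mathbb R):\theta\in(-\pi,\pi],\ j=1,\dots,n\}$. $\mathcal C_{a,r}$ is the circle of radius $r$ centered at $a$, $\mathcal C_r=\mathcal C_{0,r}$, and $\mathcal C_0=\{0\}$ by convention. For $r>0$, $C(A)\supset\mathcal C_r$ if and only if, for all $\theta$, $P_A(\lambda,\theta)$ is divisible by $\lambda^2-r^2$ as a polynomial in $\lambda$; and $C(A)\supset\mathcal C_{a,r}$ if and only if $C(A-aI)\supset\mathcal C_r$. For $6\times6$ matrices, $C(A)$ consists of the three circles $\mathcal C_{r_1},\mathcal C_{r_2},\mathcal C_{r_3}$ (counted with multiplicity) exactly when $P_A(\lambda,\theta)=\prod_{i=1}^3(\lambda^2-r_i^2)$ for all $\theta$. *)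

(* Defs.v *)
From HB Require Import structures.
From mathcomp Require Import all_boot all_order all_algebra.
From mathcomp Require Export complex.
From mathcomp Require Import all_classical all_reals all_analysis.

Set Implicit Arguments.
Unset Strict Implicit.
Unset Printing Implicit Defensive.

Import Order.TTheory GRing.Theory Num.Theory.
Import numFieldNormedType.Exports.

Local Open Scope classical_set_scope.
Local Open Scope ring_scope.
Local Open Scope complex_scope.
Local Open Scope sesquilinear_scope.

Section Notions.
Variable R : realType.
Local Notation C := R[i].

Definition expi (theta : R) : C := cos theta +i* sin theta.

Section Matrices.
Variable n : nat.
Implicit Types (A B : 'M[C]_n) (x y : 'cV[C]_n).

(* dotmx is the standard inner product on row vectors, linear in its first
   argument. *)
Definition inner x y : C := dotmx x^T y^T.

Definition vnorm x : C := sqrtC (inner x x).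

Definition partial_isometry A : Prop :=
  forall x, (forall y, A *m y = 0 -> inner x y = 0) -> vnorm (A *m x) = vnorm x.

Definition circ_equiv A B : Prop :=
  exists (U : 'M[C]_n) (theta : R),
    U \is unitarymx /\ B = expi theta *: (U *m A *m U^t*).

Definition numerical_range A : set C :=
  [set z | exists x, vnorm x = 1 /\ z = inner (A *m x) x].

Definition re_part A : 'M[C]_n := 2^-1 *: (A + A^t*).

(* The polynomial in lambda, for fixed theta, is det (Re (e^{i theta} A) -
   lambda I); it is not char_poly, from which it differs by (-1)^n. *)
Definition kippenhahn_poly A (theta : R) : {poly C} :=
  \det (map_mx polyC (re_part (expi theta *: A)) - 'X%:M).

(* A differentiable choice, near theta0, of one of the (real) roots
   lambda_j(theta). *)
Definition root_branch A (theta0 : R) (lambda : R -> R) : Prop :=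
  \forall theta \near theta0,
    root (kippenhahn_poly A theta) (lambda theta)%:C /\ derivable lambda theta 1.

(* z lies on the line e^{-i theta} (lambda(theta) + i R) iff
   F(z, theta) := Re (e^{i theta} z) - lambda(theta) = 0, and the envelope is
   given by the simultaneous equations F = 0 and dF/dtheta = 0.  The lines are
   indexed by all local differentiable branches of the roots, so that where
   branches cross each of them contributes its own point. *)
Definition kippenhahn_curve A : set C :=
  [set z | exists (theta0 : R) (lambda : R -> R),
     [/\ - pi < theta0 <= pi,
         root_branch A theta0 lambda,
         complex.Re (expi theta0 * z) - lambda theta0 = 0
       & is_derive theta0 1
           (fun theta : R => complex.Re (expi theta * z) - lambda theta) 0]].

End Matrices.

(* For r = 0 this is the singleton of the center. *)
Definition circle (a : C) (r : R) : set C := [set z | `|z - a| = r%:C].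

Definition closed_disk (a : C) (r : R) : set C := [set z | `|z - a| <= r%:C].

Definition canonical_mx (b c d e : R) (f g h : C) : 'M[C]_6 :=
  \matrix_(i < 6, j < 6)
    nth 0 (nth [::]
      [:: [:: 0; 0; 0; 1;    0;    0   ];
          [:: 0; 0; 0; 0;    b%:C; 0   ];
          [:: 0; 0; 0; 0;    c%:C; e%:C];
          [:: 0; 0; 0; 0;    d%:C; f   ];
          [:: 0; 0; 0; 0;    0;    g   ];
          [:: 0; 0; 0; 0;    0;    h   ]] i) j.

Definition phi (b c e : R) : {poly R} :=
  'X^3 - (3 / 4) *: 'X^2 + ((b ^+ 2 + c ^+ 2 + e ^+ 2 + 1) / 16) *: 'X
  - (b ^+ 2 * e ^+ 2 / 64)%:P.

End Notions.

(* Main.v *)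
Require Import Defs.
From HB Require Import structures.
From mathcomp Require Import all_boot all_order all_algebra.
From mathcomp Require Import all_classical all_reals all_analysis.
From mathcomp Require Import complex ring lra separable.

Set Implicit Arguments.
Unset Strict Implicit.
Unset Printing Implicit Defensive.

Import Order.TTheory GRing.Theory Num.Theory.
Import numFieldNormedType.Exports.

Local Open Scope classical_set_scope.
Local Open Scope ring_scope.
Local Open Scope complex_scope.

(** The matrix [A] has the same Kippenhahn polynomial, up to a shift of the
angle, as its canonical form [B]. Being a partial isometry of rank three, [B]
has orthonormal last three columns: [d^2 = 1 - b^2 - c^2],
[|f|^2 = 1 - e^2 - |g|^2] and [d f = - c e]. The Schur complement of the upper
left block of [Re (e^{i theta} B) - lambda] reduces the determinant to a 3x3 one,
which under these relations is
  [phi (lambda^2) + (c e / 16) Re (e^{i theta} g) lambda]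
([kippenhahn_canonical]).

If [c e g = 0] this is [phi (lambda^2)] for every [theta]. Its roots are
eigenvalues of a Hermitian matrix, so they are real and [phi] has three
nonnegative roots ([phi_split]). A differentiable choice of a root has zero
derivative, so the curve consists of the circles of radii [r_i]
([kippenhahn_curve_concentric]). The numerical range lies in the disk of the
largest radius [r] because [r] is the largest eigenvalue of every
[Re (e^{i theta} A)]. It contains the whole disk because, for each [theta],
suitable combinations of unit eigenvectors for [r] and [- r] realize every point
of a radius of the disk ([numerical_range_concentric]), which replaces the
convexity of the numerical range.

If [c e g <> 0], then the Kippenhahn polynomial is
[p(lambda) + Re (w kappa) lambda], with [p = phi (X^2)], [w = e^{i theta}] and
[kappa <> 0]. It is of degree one in [Re (w kappa)], so [lambda] is a rational parameter of the pair
([lambda], [Re (w kappa)]). The envelope point on the line of parameter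
[lambda] has coordinates that are algebraic in [lambda], and requiring it to lie
on a given circle of radius [r > 0] amounts to a polynomial equation in [lambda]
([elim_root]). This polynomial is not zero, by inspection of top
coefficients ([elim_poly_neq0]). Each of its finitely many roots accounts for
finitely many points of the circle, which is infinite ([no_circle]). *)

(** * Inner product and Hermitian matrices *)

Section InnerProduct.
Context {R : realType} {n : nat}.
Local Notation C := R[i].
Local Open Scope sesquilinear_scope.
Implicit Types (A B : 'M[C]_n) (x y : 'cV[C]_n).

Lemma innerE x y : inner x y = (y^t* *m x) 0 0.
Proof.
rewrite /inner dotmxE.
by rewrite -[y^T^T]trmxK -map_trmx -trmx_mul mxE trmxK -map_trmx.
Qed.

Lemma inner_sum x y : inner x y = \sum_i x i 0 * (y i 0)^*.
Proof.
by rewrite innerE mxE; apply: eq_bigr => i _; rewrite !mxE mulrC.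
Qed.

Lemma inner_adj A x y : inner (A *m x) y = inner x (A^t* *m y).
Proof. by rewrite !innerE trmx_mul map_mxM trmxCK mulmxA. Qed.

Lemma innerC x y : inner x y = (inner y x)^*.
Proof.
rewrite !inner_sum rmorph_sum; apply: eq_bigr => i _.
by rewrite rmorphM /= conjcK mulrC.
Qed.

Lemma innerDl x1 x2 y : inner (x1 + x2) y = inner x1 y + inner x2 y.
Proof. by rewrite !innerE mulmxDr mxE. Qed.

Lemma innerZl a x y : inner (a *: x) y = a * inner x y.
Proof. by rewrite !innerE -scalemxAr mxE. Qed.

Lemma innerDr x y1 y2 : inner x (y1 + y2) = inner x y1 + inner x y2.
Proof. by rewrite !innerE linearD map_mxD mulmxDl mxE. Qed.

Lemma innerZr a x y : inner x (a *: y) = conjc a * inner x y.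
Proof. by rewrite !innerE linearZ map_mxZ -scalemxAl mxE. Qed.

Lemma inner_unitary (U : 'M[C]_n) x y :
  U \is unitarymx -> inner (U *m x) (U *m y) = inner x y.
Proof.
move=> U_unitary; rewrite inner_adj mulmxA mulmx1C ?mul1mx //.
exact/unitarymxP.
Qed.

Lemma vnorm_sqr x : vnorm x ^+ 2 = inner x x.
Proof. exact: sqrtCK. Qed.

Lemma vnorm_eq x y : vnorm x = vnorm y -> inner x x = inner y y.
Proof. by move=> e; rewrite -!vnorm_sqr e. Qed.

Lemma eq_vnorm x y : inner x x = inner y y -> vnorm x = vnorm y.
Proof. by rewrite /vnorm => ->. Qed.

Lemma vnorm_eq1 x : vnorm x = 1 <-> inner x x = 1.
Proof.
split=> [e|e]; first by rewrite -vnorm_sqr e expr1n.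
by rewrite /vnorm e sqrtC1.
Qed.

(** The Hermitian part of [A] computes the real part of the values of the
quadratic form of [A]. *)
Lemma inner_re_part A x :
  inner (re_part A *m x) x = (complex.Re (inner (A *m x) x))%:C.
Proof.
rewrite /re_part -scalemxAl innerZl mulmxDl innerDl [inner (A^t* *m x) x]innerC.
by rewrite -inner_adj ReJ_add mulrC.
Qed.

Lemma re_part_herm A : (re_part A)^t* = re_part A.
Proof.
apply/matrixP => i j; rewrite !mxE rmorphM rmorphD /= !conjCK.
by rewrite fmorphV rmorph_nat addrC.
Qed.

(** The Hermitian matrix whose eigenvalues are the [d i], with the conjugates of
the rows of the unitary matrix [P] as eigenvectors. *)
Definition hermitian_diag (P : 'M[C]_n) (d : 'I_n -> R) : 'M[C]_n :=
  P^t* *m diag_mx (\row_i (d i)%:C) *m P.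

Lemma hermitian_diagonalization (H : 'M[C]_n) : H^t* = H ->
  exists (P : 'M[C]_n) (d : 'I_n -> R),
    P \is unitarymx /\ H = hermitian_diag P d.
Proof.
move=> H_herm; have H_hermsym : H \is hermsymmx.
  by apply/is_hermitianmxP; rewrite expr0 scale1r H_herm.
exists (spectralmx H), (fun i => complex.Re (spectral_diag H 0 i)).
split; first exact: spectral_unitarymx.
rewrite /hermitian_diag -invmx_unitary ?spectral_unitarymx //.
have /hermitian_normalmx/orthomx_spectralP H_eq := H_hermsym.
suff -> : \row_i (complex.Re (spectral_diag H 0 i))%:C = spectral_diag H.
  exact: H_eq.
apply/rowP => i; rewrite mxE RRe_real //.
by have /mxOverP := hermitian_spectral_diag_real H_hermsym; apply.
Qed.

Lemma mulVunitary (P : 'M[C]_n) : P \is unitarymx -> P^t* *m P = 1%:M.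
Proof. by move=> /unitarymxP/mulmx1C. Qed.

Lemma det_hermitian_diag (P : 'M[C]_n) (d : 'I_n -> R) :
  P \is unitarymx ->
  \det (map_mx polyC (hermitian_diag P d) - 'X%:M) = \prod_i ((d i)%:C%:P - 'X).
Proof.
move=> P_unitary; set D := \row_i (d i)%:C.
have -> : map_mx polyC (hermitian_diag P d) - 'X%:M =
    map_mx polyC (P^t* ) *m (diag_mx (map_mx polyC D) - 'X%:M) *m map_mx polyC P.
  rewrite mulmxBr mulmxBl mul_mx_scalar -scalemxAl -!map_mxM mulVunitary //.
  by rewrite map_mx1 scalemx1 /hermitian_diag !map_mxM map_diag_mx.
rewrite !det_mulmx mulrAC -det_mulmx -map_mxM mulVunitary // map_mx1 det1 mul1r.
have -> : diag_mx (map_mx polyC D) - 'X%:M = diag_mx (\row_i ((d i)%:C%:P - 'X)).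
  apply/matrixP => i j; rewrite !mxE -mulrnBl.
  by case: eqP => // ->.
by rewrite det_diag; apply: eq_bigr => i _; rewrite mxE.
Qed.

Lemma hermitian_diag_eigenvector (P : 'M[C]_n) (d : 'I_n -> R) i :
  P \is unitarymx ->
  exists2 v, inner v v = 1 & hermitian_diag P d *m v = (d i)%:C *: v.
Proof.
move=> P_unitary; exists (P^t* *m delta_mx i 0).
  rewrite inner_unitary ?trmxC_unitary // inner_sum (bigD1 i) //=.
  rewrite big1 => [|j ji]; last by rewrite mxE (negbTE ji) mul0r.
  by rewrite mxE !eqxx addr0 mul1r rmorph1.
rewrite /hermitian_diag -!mulmxA [P *m _]mulmxA (unitarymxP P_unitary) mul1mx.
rewrite scalemxAr; congr (_ *m _); apply/colP => j.
rewrite mul_diag_mx !mxE; case: (j =P i) => [->|_] //.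
by rewrite !mulr0.
Qed.

Lemma hermitian_diag_le (P : 'M[C]_n) (d : 'I_n -> R) (r : R) x :
  P \is unitarymx -> (forall i, d i <= r) ->
  inner (hermitian_diag P d *m x) x <= r%:C * inner x x.
Proof.
move=> P_unitary d_le; rewrite /hermitian_diag -!mulmxA.
rewrite -(inner_unitary x x P_unitary) [X in X <= _]inner_adj trmxCK.
rewrite !inner_sum mulr_sumr; apply: ler_sum => i _.
rewrite mul_diag_mx !mxE -mulrA; apply: ler_wpM2r; first exact: mul_conjC_ge0.
by rewrite lecR.
Qed.

End InnerProduct.

(** * Kippenhahn polynomial of the canonical matrix *)

Section Determinants.

(** The 3x3 matrix with the given entries, listed by rows. *)
Definition mx33 {K : nzRingType} (a00 a01 a02 a10 a11 a12 a20 a21 a22 : K) :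
    'M[K]_3 :=
  \matrix_(i < 3, j < 3)
    nth 0 (nth [::] [:: [:: a00; a01; a02]; [:: a10; a11; a12];
                       [:: a20; a21; a22]] i) j.

Lemma det_mx33 (K : comNzRingType) (a00 a01 a02 a10 a11 a12 a20 a21 a22 : K) :
  \det (mx33 a00 a01 a02 a10 a11 a12 a20 a21 a22) =
    a00 * (a11 * a22 - a12 * a21) - a01 * (a10 * a22 - a12 * a20)
    + a02 * (a10 * a21 - a11 * a20).
Proof.
rewrite (expand_det_row _ ord0) !big_ord_recl big_ord0 /cofactor.
do 3! rewrite (expand_det_row _ ord0) !big_ord_recl big_ord0 /cofactor !det_mx11 /=.
by rewrite !mxE /=; ring.
Qed.

(** Schur complement of a scalar block; the cancellation of [a ^+ n] is what
requires an integral domain. *)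
Lemma det_block_scalar (K : idomainType) n (a : K) (X Y D : 'M[K]_n) :
  a != 0 -> \det (block_mx a%:M X Y D) = \det (a *: D - Y *m X).
Proof.
move=> a_neq0; have an_neq0 : a ^+ n != 0 by rewrite expf_neq0.
apply: (mulIf an_neq0); rewrite -[in LHS]det_scalar -[\det a%:M]mul1r.
rewrite -(det1 K n) -(det_ublock _ (- X)) -det_mulmx mulmx_block.
rewrite !mulmx0 !addr0 !mulmx1 mulmxN !mul_scalar_mx mul_mx_scalar addNr.
by rewrite det_lblock det_scalar mulrC mulmxN mul_mx_scalar addrC.
Qed.

End Determinants.

Section CanonicalPolynomial.
Context {R : realType}.
Local Notation C := R[i].
Local Open Scope sesquilinear_scope.

(** The determinant of the Schur complement; [h] stands for [1/2], [x] for the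
unknown, [w] for [e^{i theta}], and [w'], [f'], [g'] for the conjugates of
[w], [f], [g]. *)
Lemma schur_det_identity (K : comNzRingType)
    (x h w w' b c d e f f' g g' : K) :
  w * w' = 1 -> d ^+ 2 = 1 - b ^+ 2 - c ^+ 2 -> f * f' = 1 - e ^+ 2 - g * g' ->
  d * f = - (c * e) -> d * f' = - (c * e) ->
  \det (mx33
    (x ^+ 2 - h ^+ 2) (- (x * (h * w * d))) (- (x * (h * w * f)))
    (- (x * (h * w' * d))) (x ^+ 2 - h ^+ 2 * (b ^+ 2 + c ^+ 2))
      (- (h ^+ 2 * (c * e)) - x * (h * w * g))
    (- (x * (h * w' * f'))) (- (h ^+ 2 * (c * e)) - x * (h * w' * g'))
      (x ^+ 2 - h ^+ 2 * e ^+ 2)) =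
  x ^+ 6 - 3 * h ^+ 2 * x ^+ 4
  + h ^+ 4 * (b ^+ 2 + c ^+ 2 + e ^+ 2 + 1) * x ^+ 2 - h ^+ 6 * (b ^+ 2 * e ^+ 2)
  + h ^+ 5 * (c * e) * (w * g + w' * g') * x.
Proof.
move=> ww dd ff df df'; rewrite det_mx33.
set u := - (h ^+ 2 * _) - _; set v := - (h ^+ 2 * _) - _.
set p11 := x ^+ 2 - h ^+ 2 * (b ^+ 2 + _).
set p22 := x ^+ 2 - h ^+ 2 * e ^+ 2.
have -> : (x ^+ 2 - h ^+ 2) * (p11 * p22 - u * v)
   - (- (x * (h * w * d))) * (- (x * (h * w' * d)) * p22
     - u * - (x * (h * w' * f')))
   + - (x * (h * w * f)) * (- (x * (h * w' * d)) * v - p11 * - (x * (h * w' * f')))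
   = (x ^+ 2 - h ^+ 2) * (p11 * p22 - u * v)
   - x ^+ 2 * h ^+ 2 * (w * w') * (d ^+ 2 * p22 + f * f' * p11
      - (d * f') * u - (d * f) * v) by ring.
rewrite ww dd ff df df' /p11 /p22 /u /v.
have -> : (- (h ^+ 2 * (c * e)) - x * (h * w * g)) *
  (- (h ^+ 2 * (c * e)) - x * (h * w' * g')) =
   h ^+ 4 * (c * e) ^+ 2 + x * h ^+ 3 * (c * e) * (w * g + w' * g') +
   x ^+ 2 * h ^+ 2 * (w * w') * (g * g') by ring.
rewrite ww.
(* both sides are [|d f|^2] *)
have rel : (1 - b ^+ 2 - c ^+ 2) * (1 - e ^+ 2 - g * g') = (c * e) ^+ 2.
  rewrite -dd -ff; transitivity ((d * f) * (d * f')); first by ring.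
  by rewrite df df'; ring.
apply/eqP; rewrite -subr_eq0; apply/eqP.
transitivity (x ^+ 2 * h ^+ 4 * ((c * e) ^+ 2
  - (1 - b ^+ 2 - c ^+ 2) * (1 - e ^+ 2 - g * g'))); first by ring.
by rewrite rel subrr mulr0.
Qed.

Lemma conjC_real (r : R) : (r%:C)^*%R = r%:C.
Proof. exact: conjc_real. Qed.

Lemma expi_conj (theta : R) : expi theta * (expi theta)^*%R = 1.
Proof.
apply/eqP; rewrite eq_complex /=; apply/andP; split; apply/eqP; last by ring.
by rewrite mulrN opprK -!expr2 cos2Dsin2.
Qed.

(** The coefficient of the linear term of the Kippenhahn polynomial, the only one
that depends on [theta]. *)
Definition coupling_coef (c e : R) (g : C) (theta : R) : R :=
  c * e / 16 * complex.Re (expi theta * g).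

Lemma kippenhahn_canonical (b c d e : R) (f g : C) (theta : R) :
  d ^+ 2 = 1 - b ^+ 2 - c ^+ 2 ->
  f * f^*%R = 1 - e%:C ^+ 2 - g * g^*%R ->
  d%:C * f = - (c * e)%:C ->
  kippenhahn_poly (canonical_mx b c d e f g 0) theta =
  map_poly (real_complex R)
    (phi b c e \Po 'X^2 + coupling_coef c e g theta *: 'X).
Proof.
move=> dd ff df; rewrite /kippenhahn_poly.
set w := expi theta; pose h : C := 2^-1.
pose Xb := mx33 (h * w) 0 0 0 (h * w * b%:C) 0 0 (h * w * c%:C) (h * w * e%:C).
pose Yb := mx33 (h * w^*%R) 0 0 0 (h * w^*%R * b%:C) (h * w^*%R * c%:C)
  0 0 (h * w^*%R * e%:C).
pose Db := mx33 0 (h * w * d%:C) (h * w * f)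
  (h * w^*%R * d%:C) 0 (h * w * g) (h * w^*%R * f^*%R) (h * w^*%R * g^*%R) 0.
have -> : re_part (w *: canonical_mx b c d e f g 0) = block_mx 0 Xb Yb Db.
  apply/matrixP => i j; rewrite !mxE /h.
  case: splitP => i' ->; rewrite mxE; case: splitP => j' ->; rewrite !mxE;
  case: i' => [[|[|[|//]]] ?]; case: j' => [[|[|[|//]]] ?] /=;
  rewrite ?rmorphM ?rmorph0 ?rmorph1 ?mulr0 ?addr0 ?add0r ?mulr0;
  by rewrite ?mulr1 ?mulrA //= conjC_real.
have -> : map_mx polyC (block_mx 0 Xb Yb Db) - 'X%:M =
    block_mx (- 'X)%:M (map_mx polyC Xb) (map_mx polyC Yb)
      (map_mx polyC Db - 'X%:M).
  rewrite map_block_mx (scalar_mx_block 3 3) opp_block_mx add_block_mx.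
  by rewrite !oppr0 !addr0 map_mx0 add0r -raddfN.
set S := - 'X *: (map_mx polyC Db - 'X%:M) - map_mx polyC Yb *m map_mx polyC Xb.
transitivity (\det S).
  by apply: (@det_block_scalar _ 3); rewrite oppr_eq0 polyX_eq0.
have ww : w%:P * (w^*%R)%:P = 1 :> {poly C} by rewrite -polyCM expi_conj.
have ddP : d%:C%:P ^+ 2 = 1 - b%:C%:P ^+ 2 - c%:C%:P ^+ 2 :> {poly C}.
  by rewrite -!polyC_exp -!rmorphXn dd !rmorphB rmorph1.
have ffP : f%:P * (f^*%R)%:P = 1 - e%:C%:P ^+ 2 - g%:P * (g^*%R)%:P :> {poly C}.
  by rewrite -!polyCM ff -!polyC_exp !rmorphB rmorph1.
have dfP : d%:C%:P * f%:P = - (c%:C%:P * e%:C%:P) :> {poly C}.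
  by rewrite -polyCM df rmorphN !rmorphM.
have dfP' : d%:C%:P * (f^*%R)%:P = - (c%:C%:P * e%:C%:P) :> {poly C}.
  have df' : d%:C * f^*%R = - (c * e)%:C.
    by have := congr1 Num.conj df; rewrite rmorphM rmorphN /= !conjC_real.
  transitivity (d%:C * f^*%R)%:P; first by rewrite polyCM.
  by rewrite df' rmorphN !rmorphM.
have := @schur_det_identity {poly C} 'X h%:P _ _ _ _ _ _ _ _ _ _ ww ddP ffP dfP dfP'.
set M := mx33 _ _ _ _ _ _ _ _ _.
have -> : S = M.
  apply/matrixP => i j; rewrite !mxE !big_ord_recr big_ord0 !mxE.
  case: i => [[|[|[|//]]] ?]; case: j => [[|[|[|//]]] ?] /=;
  by rewrite ?(polyCM, polyC0) ?mulr1n ?mulr0n; ring: ww.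
move=> ->.
pose hr : R := 2^-1.
have hE : h = hr%:C by rewrite fmorphV rmorph_nat.
have reE : w * g + w^*%R * g^*%R = 2 * (complex.Re (w * g))%:C.
  by rewrite -rmorphM; exact: addcJ.
have -> : h%:P ^+ 5 * (c%:C%:P * e%:C%:P) * (w%:P * g%:P + (w^*%R)%:P * (g^*%R)%:P)
    = (coupling_coef c e g theta)%:C%:P.
  rewrite -!polyCM -polyCD reE -polyC_exp -!polyCM hE; congr (_%:P).
  rewrite /coupling_coef; set r := complex.Re _.
  have -> : c * e / 16 * r = hr ^+ 5 * (c * e) * (2 * r) by rewrite /hr; field.
  by rewrite !(rmorphM, rmorphXn, rmorph_nat).
have q3 : (3 / 4)%:C%:P = 3 * h%:P ^+ 2 :> {poly C}.
  have -> : 3 / 4 = 3 * hr ^+ 2 by rewrite /hr; field.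
  by rewrite hE !(rmorphM, rmorphXn, rmorph_nat).
have q16 : ((b ^+ 2 + c ^+ 2 + e ^+ 2 + 1) / 16)%:C%:P =
  h%:P ^+ 4 * (b%:C%:P ^+ 2 + c%:C%:P ^+ 2 + e%:C%:P ^+ 2 + 1) :> {poly C}.
  have -> : (b ^+ 2 + c ^+ 2 + e ^+ 2 + 1) / 16 =
    hr ^+ 4 * (b ^+ 2 + c ^+ 2 + e ^+ 2 + 1) by rewrite /hr; field.
  by rewrite hE !(rmorphM, rmorphD, rmorphXn, rmorph1).
have q64 : (b ^+ 2 * e ^+ 2 / 64)%:C%:P =
  h%:P ^+ 6 * (b%:C%:P ^+ 2 * e%:C%:P ^+ 2) :> {poly C}.
  have -> : b ^+ 2 * e ^+ 2 / 64 = hr ^+ 6 * (b ^+ 2 * e ^+ 2).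
    by rewrite /hr; field.
  by rewrite hE !(rmorphM, rmorphXn).
rewrite /phi; move: (coupling_coef c e g theta) => k.
set k3 := 3 / 4 in q3 *; set k16 := _ / 16 in q16 *; set k64 := _ / 64 in q64 *.
clearbody k3 k16 k64.
rewrite comp_polyB comp_polyD comp_polyB !comp_polyZ !comp_Xn_poly comp_polyX comp_polyC.
rewrite -!exprM rmorphD rmorphB rmorphD rmorphB /= !map_polyZ !map_polyXn map_polyX.
rewrite map_polyC /= -!mul_polyC q3 q16 q64.
by ring.
Qed.

End CanonicalPolynomial.

(** * Circular equivalence and orthonormality of the columns *)

Section CircularEquivalence.
Context {R : realType} {n : nat}.
Local Notation C := R[i].
Local Open Scope sesquilinear_scope.
Implicit Types (A B : 'M[C]_n) (x y : 'cV[C]_n).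

Lemma expiD (s t : R) : expi (s + t) = expi s * expi t.
Proof.
rewrite /expi cosD sinD; apply/eqP; rewrite eq_complex /=.
by rewrite eqxx /=; apply/eqP; ring.
Qed.

Lemma kippenhahn_circ A (U : 'M[C]_n) (tau theta : R) : U \is unitarymx ->
  kippenhahn_poly (expi tau *: (U *m A *m U^t*)) theta =
  kippenhahn_poly A (theta + tau).
Proof.
move=> U_unitary; rewrite /kippenhahn_poly scalerA -expiD.
set D := expi _ *: A; set w := expi _.
have -> : re_part (w *: (U *m A *m U^t*)) = U *m re_part D *m U^t*.
  rewrite /re_part -scalemxAr -scalemxAl mulmxDr mulmxDl; congr (_ *: (_ + _)).
    by rewrite /D -scalemxAr -scalemxAl.
  rewrite /D !linearZ /= !map_mxZ !trmx_mul !map_mxM trmxCK.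
  by rewrite -scalemxAr -scalemxAl mulmxA.
have -> : map_mx polyC (U *m re_part D *m U^t*) - 'X%:M =
    map_mx polyC U *m (map_mx polyC (re_part D) - 'X%:M) *m map_mx polyC (U^t* ).
  rewrite mulmxBr mulmxBl mul_mx_scalar -scalemxAl -!map_mxM (unitarymxP U_unitary).
  by rewrite map_mx1 scalemx1.
rewrite !det_mulmx mulrAC -det_mulmx -map_mxM (unitarymxP U_unitary).
by rewrite map_mx1 det1 mul1r.
Qed.

Lemma mxrank_circ A (U : 'M[C]_n) (tau : R) : U \is unitarymx ->
  \rank (expi tau *: (U *m A *m U^t*)) = \rank A.
Proof.
move=> U_unitary; rewrite mxrank_scale_nz; last first.
  by apply/eqP => w0; have := expi_conj tau; rewrite w0 mul0r => /esym/eqP;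
     rewrite oner_eq0.
rewrite mxrankMfree ?row_free_unit ?unitarymx_unit ?trmxC_unitary //.
by rewrite -mxrank_tr trmx_mul mxrankMfree ?mxrank_tr //
  row_free_unit unitmx_tr unitarymx_unit.
Qed.

Lemma partial_isometry_circ A (U : 'M[C]_n) (tau : R) : U \is unitarymx ->
  partial_isometry A -> partial_isometry (expi tau *: (U *m A *m U^t*)).
Proof.
move=> U_unitary A_pisom x x_perp.
have UU : U^t* *m U = 1%:M by exact: mulVunitary.
have key : inner (A *m (U^t* *m x)) (A *m (U^t* *m x)) = inner (U^t* *m x) (U^t* *m x).
  apply: vnorm_eq; apply: A_pisom => y Ay0.
  rewrite inner_adj trmxCK; apply: x_perp.
  by rewrite -scalemxAl -!mulmxA [U^t* *m _]mulmxA UU mul1mx Ay0 !mulmx0 scaler0.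
apply: eq_vnorm.
rewrite -!scalemxAl innerZl innerZr mulrA expi_conj mul1r -!mulmxA.
rewrite (inner_unitary _ _ U_unitary) key; apply: inner_unitary.
by rewrite trmxC_unitary.
Qed.

End CircularEquivalence.

Section CanonicalRelations.
Context {R : realType}.
Local Notation C := R[i].
Local Open Scope sesquilinear_scope.

(** The first three columns of the canonical matrix vanish; when its rank is
three, the first three basis vectors span the kernel, so the norm of
[(0, 0, 0, 0, p, q)] is preserved. *)
Lemma canonical_isometry (b c d e : R) (f g : C) (p q : C) :
  \rank (canonical_mx b c d e f g 0) = 3%N ->
  partial_isometry (canonical_mx b c d e f g 0) ->
  b%:C ^+ 2 * (p * p^*%R) + (c%:C * p + e%:C * q) * (c%:C * p^*%R + e%:C * q^*%R)
  + (d%:C * p + f * q) * (d%:C * p^*%R + f^*%R * q^*%R) + g * g^*%R * (q * q^*%R)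
  = p * p^*%R + q * q^*%R.
Proof.
set B := canonical_mx _ _ _ _ _ _ _ => B_rank B_pisom.
pose v : 'cV[C]_6 := \col_(i < 6) nth 0 [:: 0; 0; 0; 0; p; q] i.
have B_ker (y : 'cV[C]_6) : B *m y = 0 -> forall i : 'I_6, (2 < i)%N -> y i 0 = 0.
  pose Z : 'M[C]_(6, 3) := @rsubmx C 6 3 3 B.
  have BZ : B = @row_mx C 6 3 3 0 Z.
    suff <- : @lsubmx C 6 3 3 B = 0 by rewrite hsubmxK.
    apply/matrixP => i j; rewrite !mxE /=.
    by case: j => [[|[|[|//]]] ?]; case: i => [[|[|[|[|[|[|//]]]]]] ?].
  have Z_rank : \rank Z = 3%N.
    rewrite -(@rank_row_0mx _ 6 3 3 Z).
    exact: etrans (congr1 (@mxrank C 6 6) (esym BZ)) B_rank.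
  move=> By0; pose yu := @usubmx C 3 3 1 y; pose yd := @dsubmx C 3 3 1 y.
  have yE : y = @col_mx C 3 3 1 yu yd by rewrite vsubmxK.
  have Zyd : Z *m yd = 0.
    by move: By0; rewrite BZ yE (@mul_row_col _ 6 3 3) mul0mx add0r.
  have yd0 : yd = 0.
    apply: trmx_inj; apply/eqP; rewrite trmx0.
    rewrite -(@mulmx_free_eq0 _ _ _ _ _ Z^T) -?trmx_mul ?Zyd ?trmx0 //.
    by rewrite /row_free mxrank_tr Z_rank.
  move=> i i_gt2; rewrite yE mxE; case: splitP => j ij; last by rewrite yd0 mxE.
  by move: i_gt2; rewrite ij ltnNge -ltnS ltn_ord.
have /vnorm_eq : vnorm (B *m v) = vnorm v.
  apply: B_pisom => y /B_ker y0; rewrite inner_sum big1 // => i _.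
  case: (ltnP 2 i) => [/y0 ->|]; first by rewrite conjC0 mulr0.
  by rewrite mxE; case: i => [[|[|[|//]]] ?] _; rewrite mul0r.
rewrite !inner_sum !big_ord_recl !big_ord0 !mxE !big_ord_recl !big_ord0 !mxE /=.
rewrite !(mulr0, mul0r, mulr1, mul1r, addr0, add0r, conjC0).
rewrite !(rmorphD, rmorphM) /= !conjC_real => <-.
by ring.
Qed.

Lemma canonical_orthonormal (b c d e : R) (f g : C) :
  \rank (canonical_mx b c d e f g 0) = 3%N ->
  partial_isometry (canonical_mx b c d e f g 0) ->
  [/\ d ^+ 2 = 1 - b ^+ 2 - c ^+ 2, f * f^*%R = 1 - e%:C ^+ 2 - g * g^*%R
    & d%:C * f = - (c * e)%:C].
Proof.
move=> B_rank B_pisom.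
have rel p q := @canonical_isometry b c d e f g p q B_rank B_pisom.
have := rel 1 0; rewrite conjC0 conjC1 !(mulr0, mulr1, addr0) => rel10.
have := rel 0 1; rewrite conjC0 conjC1 !(mulr0, mulr1, add0r) => rel01.
have := rel 1 1; rewrite conjC1 !mulr1 => rel11.
have := rel 1 'i%R; rewrite conjC1 conjCi !mulr1 => rel1i.
have ii : 'i%R * 'i%R = -1 :> C by rewrite -expr2 sqrCi.
(* the relations for [p = 0] and [q = 0] are subtracted from mixed ones *)
have comb (x1 x2 y1 y2 z1 z2 : C) : x1 = x2 -> y1 = y2 -> z1 = z2 ->
  (x1 - x2) - (y1 - y2) - (z1 - z2) = 0 by move=> -> -> ->; rewrite !subrr.
have sum_df : d%:C * f + d%:C * f^*%R = - (2 * (c%:C * e%:C)).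
  apply/eqP; rewrite -subr_eq0; apply/eqP.
  rewrite -[RHS](comb _ _ _ _ _ _ rel11 rel10 rel01); ring.
have diff_df : 'i%R * (d%:C * f - d%:C * f^*%R) = 0.
  rewrite -[RHS](comb _ _ _ _ _ _ rel1i rel10 rel01); ring: ii.
split.
- apply: complexI; rewrite !rmorphB !rmorphXn rmorph1 /=.
  by rewrite -rel10; ring.
- by rewrite -rel01; ring.
- have /eqP := diff_df; rewrite mulf_eq0 (negbTE (neq0Ci _)) subr_eq0 => /eqP df.
  have two0 : 2 != 0 :> C by rewrite pnatr_eq0.
  apply: (mulfI two0); rewrite rmorphM mulrN -sum_df -df; ring.
Qed.

End CanonicalRelations.

(** * Tangency equations for points of the curve *)

Section Branches.
Context {R : realType}.
Local Notation C := R[i].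

Lemma Re_expi (theta : R) (z : C) : complex.Re (expi theta * z) =
  cos theta * complex.Re z - sin theta * complex.Im z.
Proof. by case: z. Qed.

Lemma Im_expi (theta : R) (z : C) : complex.Im (expi theta * z) =
  cos theta * complex.Im z + sin theta * complex.Re z.
Proof. by case: z. Qed.

Lemma is_derive_Re_expi (theta : R) (z : C) :
  is_derive theta 1 (fun t : R => complex.Re (expi t * z))
    (- complex.Im (expi theta * z)).
Proof.
have -> : (fun t : R => complex.Re (expi t * z)) =
    complex.Re z *: (@cos R) - complex.Im z *: (@sin R).
  by apply/funext => t; rewrite Re_expi !fctE /GRing.scale /=; ring.
apply: is_derive_eq; rewrite Im_expi /GRing.scale /=; ring.
Qed.

(** Implicit differentiation of [p lambda + Re (e^{i theta} kappa) lambda = 0]. *)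
Lemma branch_derivative (p : {poly R}) (kappa : C) (lambda : R -> R)
    (theta0 dl : R) :
  is_derive theta0 1 lambda dl ->
  (\forall theta \near theta0, p.[lambda theta] +
     complex.Re (expi theta * kappa) * lambda theta = 0) ->
  dl * (p^`().[lambda theta0] + complex.Re (expi theta0 * kappa)) =
    complex.Im (expi theta0 * kappa) * lambda theta0.
Proof.
move=> lambdaD eq0.
have kappaD := is_derive_Re_expi theta0 kappa.
pose G := (horner p \o lambda) + (fun t => complex.Re (expi t * kappa)) * lambda.
have GD := is_deriveD (is_derive1_comp (is_derive_poly p (lambda theta0)) lambdaD)
  (is_deriveM kappaD lambdaD).
have [_ G'] := GD.
have : 'D_1 G theta0 = 'D_1 (cst 0 : R -> R) theta0.
  by apply: near_eq_derive => //; near do rewrite /G fctE.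
rewrite G' derive_cst /GRing.scale /= => E.
by apply/eqP; rewrite -subr_eq0 -[X in _ == X]E; apply/eqP; ring.
Unshelve. all: by end_near.
Qed.

(** With [w = e^{i theta}], a point [z] of the curve lies on the line of parameter
[lambda = Re (w z)], and the derivative of the branch is [- Im (w z)]. *)
Lemma kippenhahn_curve_point n (A : 'M[C]_n) (p : {poly R}) (kappa z : C) :
  (forall theta x, root (kippenhahn_poly A theta) x%:C ->
     p.[x] + complex.Re (expi theta * kappa) * x = 0) ->
  kippenhahn_curve A z ->
  exists w : C, [/\ w * w^*%R = 1,
    p.[complex.Re (w * z)] + complex.Re (w * kappa) * complex.Re (w * z) = 0 &
    - complex.Im (w * z) * (p^`().[complex.Re (w * z)] + complex.Re (w * kappa)) =
      complex.Im (w * kappa) * complex.Re (w * z)].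
Proof.
move=> rootP [theta0 [lambda [_ branch /eqP]]]; rewrite subr_eq0 => /eqP zE zD.
have root_near : \forall theta \near theta0, p.[lambda theta] +
    complex.Re (expi theta * kappa) * lambda theta = 0.
  by near=> theta; apply: rootP; near: theta; move: branch;
     apply: filterS => theta [].
have lambdaD : is_derive theta0 1 lambda (- complex.Im (expi theta0 * z)).
  have zD' := is_derive_Re_expi theta0 z.
  have := is_deriveB zD' zD; rewrite subr0; congr is_derive.
  by apply/funext => t; rewrite !fctE; ring.
exists (expi theta0); split; first exact: expi_conj.
  by rewrite zE (nbhs_singleton root_near).
by rewrite zE (branch_derivative lambdaD root_near).
Unshelve. all: by end_near.
Qed.

End Branches.

(** * Top coefficients of polynomials *)

Section TopCoefficient.
Context {K : comNzRingType}.
Implicit Types p q : {poly K}.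

(** [has_top n c p]: the degree of [p] is at most [n], and the coefficient of
['X^n], which may vanish, is [c]. *)
Definition has_top n (c : K) p := (size p <= n.+1)%N /\ p`_n = c.

Lemma has_topM m n c d p q :
  has_top m c p -> has_top n d q -> has_top (m + n) (c * d) (p * q).
Proof.
move=> [sp <-] [sq <-]; split.
  apply: leq_trans (size_polyMleq _ _) _; rewrite -ltnS.
  case: (size p + size q)%N (leq_add sp sq) => //= k.
  by rewrite addSn addnS !ltnS.
have m_lt : (m < (m + n).+1)%N by rewrite ltnS leq_addr.
rewrite coefM (bigD1 (Ordinal m_lt)) //= addKn big1 ?addr0 // => i im.
have {}im : (i : nat) != m by apply: contraNneq im => im; apply/eqP/val_inj.
case: (ltngtP i m) im => // [i_lt|i_gt] _; last first.
  by rewrite (nth_default _ (leq_trans sp i_gt)) mul0r.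
by rewrite [q`__]nth_default ?mulr0 // (leq_trans sq) // ltn_subRL ltn_add2r.
Qed.

Lemma has_topD n c d p q : has_top n c p -> has_top n d q -> has_top n (c + d) (p + q).
Proof.
move=> [sp <-] [sq <-]; split; last by rewrite coefD.
by apply: leq_trans (size_polyD _ _) _; rewrite geq_max sp sq.
Qed.

Lemma has_topZ n c d p : has_top n c p -> has_top n (d * c) (d *: p).
Proof.
move=> [sp <-]; split; last by rewrite coefZ.
exact: leq_trans (size_scale_leq _ _) _.
Qed.

Lemma has_topN n c p : has_top n c p -> has_top n (- c) (- p).
Proof. by move=> [sp <-]; split; rewrite ?coefN ?size_polyN. Qed.

Lemma has_top_lt m n c p : (m < n)%N -> has_top m c p -> has_top n 0 p.
Proof.
move=> mn [sp _]; split; last by rewrite nth_default // (leq_trans sp).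
by rewrite (leq_trans sp) // ltnS ltnW.
Qed.

Lemma has_topX n : has_top n 1 ('X^n : {poly K}).
Proof. by split; rewrite ?coefXn ?eqxx // size_polyXn. Qed.

Lemma has_top_neq0 n c p : has_top n c p -> c != 0 -> p != 0.
Proof. by move=> [_ <-]; apply: contraNneq => ->; rewrite coef0. Qed.

End TopCoefficient.

(** * No circle when the linear term is present *)

Section NoCircle.
Context {R : realType}.
Local Notation C := R[i].

(** Let [l], [S], [T] and [m] be the values of [Re (w z)], [Re (w kappa)],
[Im (w kappa)] and [- Im (w z)] at a point [z] of the curve, and [k] the square
of [|kappa|]. On the curve [S = - p / l] and [m * elim_N p = T * l ^+ 2], all
polynomials being evaluated at [l], so multiplication by [elim_N p] clears the
denominators of the coordinates of [z]. *)
Definition elim_N (p : {poly R}) := 'X * p^`() - p.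

(** The equation, multiplied by [elim_N p ^+ 2], of the circle with centre
[(a1, a2)] and squared radius [s] at the point [z] times the conjugate of
[kappa], whose coordinates are [l * S - m * T] and [Y = - (m * S + l * T)],
without its term [- 2 * a2 * Y], the only one with an odd power of [T]. *)
Definition elim_E (p : {poly R}) (k a1 a2 s : R) : {poly R} :=
  k *: ('X^2 * (elim_N p ^+ 2 + k *: 'X^2 - p ^+ 2))
  - (2 * a1) *: ((p ^+ 2 - p * elim_N p - k *: 'X^2) * elim_N p)
  + (a1 ^+ 2 + a2 ^+ 2 - s) *: elim_N p ^+ 2.

(** Once the term in [Y] is isolated and squared, [T] occurs only through
[T ^+ 2 * l ^+ 2 = k * l ^+ 2 - p ^+ 2]. *)
Definition elim_poly p k a1 a2 s : {poly R} :=
  elim_E p k a1 a2 s ^+ 2 - (4 * a2 ^+ 2) *: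
    (elim_N p ^+ 2 * (elim_N p - p) ^+ 2 * (k *: 'X^2 - p ^+ 2)).

Lemma elim_root (p : {poly R}) (k a1 a2 s l m S T : R) :
  S ^+ 2 + T ^+ 2 = k -> p.[l] + S * l = 0 -> m * (p^`().[l] + S) = T * l ->
  (l * S - m * T - a1) ^+ 2 + (- (m * S + l * T) - a2) ^+ 2 = s ->
  root (elim_poly p k a1 a2 s) l.
Proof.
move=> STk pl ml circ; apply/rootP.
rewrite /elim_poly /elim_E /elim_N !hornerE /=.
set q := p.[l] in pl *; set q' := p^`().[l] in ml *.
have qE : q = - (S * l) by apply/eqP; rewrite -addr_eq0 pl.
pose N := l * q' - q.
have mN : m * N = T * l ^+ 2.
  transitivity (l * (m * (q' + S))); first by rewrite /N qE; ring.
  by rewrite ml; ring.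
have Tl : T ^+ 2 * l ^+ 2 = k * l ^+ 2 - q ^+ 2 by rewrite -STk qE; ring.
have mN2 : (m * N) ^+ 2 = l ^+ 2 * (k * l ^+ 2 - q ^+ 2).
  by rewrite mN -Tl; ring.
set X := l * S - m * T in circ; set Y := - (m * S + l * T) in circ.
have XN : X * N = q ^+ 2 - q * N - k * l ^+ 2.
  transitivity (- q * N - T * (m * N)); first by rewrite /X qE; ring.
  transitivity (- q * N - T ^+ 2 * l ^+ 2); first by rewrite mN; ring.
  by rewrite Tl; ring.
have YN : Y * N = - (l * T * (N - q)).
  transitivity (- (S * (m * N) + l * T * N)); first by rewrite /Y; ring.
  by rewrite mN qE; ring.
have EE : k * (l ^+ 2 * (N ^+ 2 + k * l ^+ 2 - q ^+ 2))
    - 2 * a1 * ((q ^+ 2 - q * N - k * l ^+ 2) * N)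
    + (a1 ^+ 2 + a2 ^+ 2 - s) * N ^+ 2 = 2 * a2 * (Y * N) * N.
  transitivity (k * (l ^+ 2 * N ^+ 2 + (m * N) ^+ 2) - 2 * a1 * ((X * N) * N)
      + (a1 ^+ 2 + a2 ^+ 2 - s) * N ^+ 2); first by rewrite mN2 XN; ring.
  by rewrite -circ -STk /X /Y; ring.
transitivity ((k * (l ^+ 2 * (N ^+ 2 + k * l ^+ 2 - q ^+ 2))
    - 2 * a1 * ((q ^+ 2 - q * N - k * l ^+ 2) * N)
    + (a1 ^+ 2 + a2 ^+ 2 - s) * N ^+ 2) ^+ 2
    - 4 * a2 ^+ 2 * (N ^+ 2 * (N - q) ^+ 2 * (k * l ^+ 2 - q ^+ 2))).
  by rewrite -/N; ring.
by rewrite EE YN -Tl; ring.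
Qed.

(** If the centre is nonzero, the coefficient of degree 36 is a positive multiple
of its squared modulus; if it is zero, [elim_E] has degree 14. *)
Lemma elim_poly_neq0 (p : {poly R}) (k a1 a2 s : R) :
  p \is monic -> size p = 7%N -> 0 < k -> elim_poly p k a1 a2 s != 0.
Proof.
move=> p_monic p_size k_gt0.
have p_top : has_top 6 1 p.
  by split; rewrite ?p_size //; have := monicP p_monic; rewrite lead_coefE p_size.
have N_top : has_top 6 5 (elim_N p).
  split.
    apply: leq_trans (size_polyD _ _) _; rewrite geq_max size_polyN p_size leqnn andbT.
    rewrite (leq_trans (size_polyMleq _ _)) // size_polyX add2n /= ltnS.
    by have := lt_size_deriv (monic_neq0 p_monic); rewrite p_size.
  by rewrite coefB coefXM coef_deriv /= p_top.2; ring.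
have X2_top : has_top 2 1 ('X^2 : {poly R}) by exact: has_topX.
have kX2 n : (2 < n)%N -> has_top n 0 (k *: 'X^2).
  by move=> n2; apply: has_top_lt n2 _; exact: has_topZ X2_top.
have pp := has_topM p_top p_top; have NN := has_topM N_top N_top.
have pN := has_topM p_top N_top.
have Np : has_top 6 4 (elim_N p - p).
  by have := has_topD N_top (has_topN p_top); congr has_top; ring.
have kpN : has_top 12 (- 4) (p ^+ 2 - p * elim_N p - k *: 'X^2).
  have := has_topD (has_topD pp (has_topN pN)) (has_topN (kX2 12 isT)).
  by rewrite -expr2; congr has_top; ring.
have kNp : has_top 12 24 (elim_N p ^+ 2 + k *: 'X^2 - p ^+ 2).
  have := has_topD (has_topD NN (kX2 12 isT)) (has_topN pp).
  by rewrite -!expr2; congr has_top; ring.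
have main := has_topZ k (has_topM X2_top kNp).
have lin := has_topZ (2 * a1) (has_topM kpN N_top).
have cst := has_topZ (a1 ^+ 2 + a2 ^+ 2 - s) NN.
have [/andP[/eqP a1_0 /eqP a2_0]|a_neq0] := boolP ((a1 == 0) && (a2 == 0)).
  subst a1 a2; have E_top : has_top 14 (k * 24) (elim_E p k 0 0 s).
    have := has_topD main (has_topZ (0 ^+ 2 + 0 ^+ 2 - s)
      (has_top_lt (m := 12) (n := 14) isT NN)).
    rewrite /elim_E !mulr0 scale0r subr0 -!expr2.
    by congr has_top; ring.
  rewrite /elim_poly expr0n /= mulr0 scale0r subr0 expf_neq0 //.
  by apply: has_top_neq0 E_top _; rewrite mulf_neq0 ?gt_eqF.
have E_top : has_top 18 (40 * a1) (elim_E p k a1 a2 s).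
  have := has_topD (has_topD (has_top_lt (m := 14) (n := 18) isT main) (has_topN lin))
    (has_top_lt (m := 12) (n := 18) isT cst).
  rewrite -!expr2; congr has_top; ring.
have rest : has_top 36 (- 400)
    (elim_N p ^+ 2 * (elim_N p - p) ^+ 2 * (k *: 'X^2 - p ^+ 2)).
  have := has_topM (has_topM NN (has_topM Np Np)) (has_topD (kX2 12 isT) (has_topN pp)).
  by rewrite -!expr2; congr has_top; ring.
have T_top : has_top 36 (1600 * (a1 ^+ 2 + a2 ^+ 2)) (elim_poly p k a1 a2 s).
  have := has_topD (has_topM E_top E_top) (has_topN (has_topZ (4 * a2 ^+ 2) rest)).
  by rewrite -!expr2; congr has_top; ring.
apply: has_top_neq0 T_top _; rewrite mulf_neq0 ?pnatr_eq0 //.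
by rewrite paddr_eq0 ?sqr_ge0 // !sqrf_eq0.
Qed.

Lemma poly_roots_seq (q : {poly R}) : q != 0 ->
  exists rs : seq R, forall x, root q x -> x \in rs.
Proof.
move=> q_neq0; pose qC := map_poly (real_complex R) q.
have [rs qE] := closed_field_poly_normal qC.
exists (map (@complex.Re R) rs) => x qx.
have : root qC x%:C by rewrite fmorph_root.
rewrite qE rootZ ?lead_coef_eq0 ?map_poly_eq0 // root_prod_XsubC => x_rs.
by apply/mapP; exists x%:C.
Qed.

Lemma circle_not_covered (a : C) (r : R) (s : seq C) : 0 < r ->
  exists2 z, circle a r z & z \notin s.
Proof.
move=> r_gt0; pose c (j : nat) : R := j.+1%:R^-1.
pose pt j : C := a + r%:C * (c j +i* Num.sqrt (1 - c j ^+ 2)).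
have ptP j : circle a r (pt j).
  rewrite /circle /= /pt [a + _]addrC addrK normrM normc_def /= expr0n addr0.
  rewrite sqrtr_sqr gtr0_norm // normc_def /= sqr_sqrtr; last first.
    rewrite subr_ge0 expr_le1 // ?invr_ge0 ?ler0n // invf_le1 ?ltr0n //.
    by rewrite ler1n.
  have -> : c j ^+ 2 + (1 - c j ^+ 2) = 1 by ring.
  by rewrite sqrtr1 rmorph1 mulr1.
have pt_inj : injective pt.
  move=> i j /addrI/mulfI; rewrite eq_complex /= eqxx andbT gt_eqF // => /(_ isT).
  by move=> -[] /invr_inj/eqP; rewrite eqr_nat => /eqP [].
case: (pselect (exists j, pt j \notin s)) => [[j js]|all_s]; first by exists (pt j).
have {}all_s j : pt j \in s by apply: contrapT => /negP js; apply: all_s; exists j.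
have := @uniq_leq_size _ (map pt (iota 0 (size s).+1)) s.
rewrite map_inj_uniq // iota_uniq size_map size_iota ltnn => /(_ isT) H.
suff: false by []; apply: H => _ /mapP [j _ ->]; exact: all_s.
Qed.

Lemma sqrt_signed (x y : R) : x ^+ 2 = y ->
  exists2 e, e \in [:: 1; -1] & x = e * Num.sqrt y.
Proof.
move=> <-; rewrite sqrtr_sqr; case: (lerP 0 x) => x0.
  by exists 1; rewrite ?inE ?eqxx // mul1r ger0_norm.
by exists (-1); rewrite ?inE ?eqxx ?orbT // mulN1r ltr0_norm ?opprK.
Qed.

(** The points where the circle of centre [a] and radius [r] meets the line
[Re (w z) = l], for a unimodular [w] such that [Re (w kappa) = S l]. The
signs [e1] and [e2] select [Im (w kappa)] and the point on the line. *)
Definition line_circle_point (S : R -> R) (kappa a : C) (r l e1 e2 : R) : C :=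
  let k := complex.Re (kappa * kappa^*%R) in
  let w := (S l +i* (e1 * Num.sqrt (k - S l ^+ 2))) / kappa in
  w^*%R * (l +i* (complex.Im (w * a)
    + e2 * Num.sqrt (r ^+ 2 - (l - complex.Re (w * a)) ^+ 2))).

Lemma Re_mul_conj (u : C) :
  complex.Re (u * u^*%R) = complex.Re u ^+ 2 + complex.Im u ^+ 2.
Proof. by case: u => x y /=; ring. Qed.

Lemma circle_mul_conj (a z : C) (r : R) :
  circle a r z -> (z - a) * (z - a)^*%R = (r ^+ 2)%:C.
Proof. by rewrite /circle /= -normCK => ->; rewrite rmorphXn. Qed.

Lemma line_circle_pointP (S : R -> R) (kappa a w z : C) (r : R) :
  kappa != 0 -> w * w^*%R = 1 -> circle a r z ->
  complex.Re (w * kappa) = S (complex.Re (w * z)) ->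
  exists e1 e2, [/\ e1 \in [:: 1; -1], e2 \in [:: 1; -1] &
    z = line_circle_point S kappa a r (complex.Re (w * z)) e1 e2].
Proof.
move=> kappa_neq0 ww /circle_mul_conj z_circ wS.
have im_w : complex.Im (w * kappa) ^+ 2 =
    complex.Re (kappa * kappa^*%R) - S (complex.Re (w * z)) ^+ 2.
  apply/eqP; rewrite eq_sym subr_eq -wS [_ + _ ^+ 2]addrC -Re_mul_conj; apply/eqP.
  by rewrite rmorphM mulrACA ww mul1r.
have im_z : (complex.Im (w * z) - complex.Im (w * a)) ^+ 2 =
    r ^+ 2 - (complex.Re (w * z) - complex.Re (w * a)) ^+ 2.
  apply/eqP; rewrite eq_sym subr_eq addrC -!raddfB -Re_mul_conj -mulrBr.
  by rewrite rmorphM mulrACA ww mul1r z_circ.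
have [e1 e1P w_im] := sqrt_signed im_w; have [e2 e2P z_im] := sqrt_signed im_z.
exists e1, e2; split=> //; rewrite /line_circle_point -w_im -wS.
have -> : (complex.Re (w * kappa) +i* complex.Im (w * kappa)) = w * kappa.
  by case: (w * kappa).
rewrite mulfK //; cbv zeta; rewrite -z_im addrC subrK.
have -> : (complex.Re (w * z) +i* complex.Im (w * z)) = w * z by case: (w * z).
by rewrite mulrA [w^*%R * w]mulrC ww mul1r.
Qed.

Lemma no_circle n (A : 'M[C]_n) (p : {poly R}) (kappa a : C) (r : R) :
  (forall theta x, root (kippenhahn_poly A theta) x%:C ->
     p.[x] + complex.Re (expi theta * kappa) * x = 0) ->
  p \is monic -> size p = 7%N -> kappa != 0 -> 0 < r ->
  ~ circle a r `<=` kippenhahn_curve A.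
Proof.
move=> rootP p_monic p_size kappa_neq0 r_gt0 sub_curve.
(* the circle is multiplied by the conjugate of [kappa] *)
pose k := complex.Re (kappa * kappa^*%R).
pose a' := a * kappa^*%R.
have k_gt0 : 0 < k.
  rewrite /k Re_mul_conj lt_neqAle addr_ge0 ?sqr_ge0 // andbT eq_sym.
  rewrite paddr_eq0 ?sqr_ge0 // !sqrf_eq0.
  by move: kappa_neq0; rewrite eq_complex.
have [rs rsP] := poly_roots_seq
  (elim_poly_neq0 (complex.Re a') (complex.Im a') (k * r ^+ 2) p_monic p_size k_gt0).
(* at [l = 0] the tangency equation, not the root equation, gives [Re (w kappa)];
   the point 0 is the only one where it does not *)
pose S l := if l == 0 then - p^`().[0] else - p.[l] / l.
pose signs : seq R := [:: 1; -1].
pose pts := 0 :: [seq line_circle_point S kappa a r le.1 le.2 e2 |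
  le <- [seq (l, e1) | l <- rs, e1 <- signs], e2 <- signs].
have [z z_circ] := circle_not_covered a pts r_gt0.
apply/negP; rewrite negbK /pts in_cons.
have [w [ww eq0 eq1]] := kippenhahn_curve_point rootP (sub_curve _ z_circ).
have l_rs : complex.Re (w * z) \in rs.
  apply/rsP/(elim_root _ eq0 eq1).
    by rewrite -Re_mul_conj rmorphM mulrACA ww mul1r.
  have -> : complex.Re (w * z) * complex.Re (w * kappa)
     - - complex.Im (w * z) * complex.Im (w * kappa) = complex.Re (z * kappa^*%R).
    transitivity (complex.Re ((w * z) * (w * kappa)^*%R)).
      by case: (w * z) (w * kappa) => [? ?] [? ?] /=; ring.
    by rewrite rmorphM mulrACA ww mul1r.
  have -> : - (- complex.Im (w * z) * complex.Re (w * kappa) +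
      complex.Re (w * z) * complex.Im (w * kappa)) = complex.Im (z * kappa^*%R).
    transitivity (complex.Im ((w * z) * (w * kappa)^*%R)).
      by case: (w * z) (w * kappa) => [? ?] [? ?] /=; ring.
    by rewrite rmorphM mulrACA ww mul1r.
  rewrite -!raddfB -Re_mul_conj -mulrBl rmorphM /= conjCK mulrACA.
  rewrite (circle_mul_conj z_circ) [kappa^*%R * _]mulrC /k.
  by case: (kappa * kappa^*%R) => x y /=; ring.
have [wz0|wz_neq0] := eqVneq (w * z) 0.
  have w_neq0 : w != 0.
    by apply: contra_eq_neq ww => ->; rewrite mul0r eq_sym oner_eq0.
  by move/eqP: wz0; rewrite mulf_eq0 (negbTE w_neq0) /= => ->.
have wS : complex.Re (w * kappa) = S (complex.Re (w * z)).
  rewrite /S; have [l0|l_neq0] := eqVneq (complex.Re (w * z)) 0.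
    move: eq1 wz_neq0; rewrite l0 mulr0 eq_complex l0 eqxx /= => /eqP.
    rewrite mulf_eq0 oppr_eq0 => /orP [->//|+ _].
    by rewrite addrC addr_eq0 => /eqP.
  apply: (mulIf l_neq0); rewrite divfK //; apply/eqP.
  by rewrite -addr_eq0 addrC eq0.
have [e1 [e2 [e1P e2P ->]]] := line_circle_pointP kappa_neq0 ww z_circ wS.
apply/orP; right.
have -> : line_circle_point S kappa a r (complex.Re (w * z)) e1 e2 =
  (fun le e => line_circle_point S kappa a r le.1 le.2 e)
    (complex.Re (w * z), e1) e2 by [].
by apply: allpairs_f => //; exact: allpairs_f.
Qed.

End NoCircle.

(** * Concentric circles *)

Section ConcentricCircles.
Context {R : realType}.
Local Notation C := R[i].
Local Open Scope sesquilinear_scope.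

Lemma expi_surj (u : C) : u * u^*%R = 1 ->
  exists2 theta : R, - pi < theta <= pi & expi theta = u.
Proof.
case: u => x y uu; have xy : x ^+ 2 + y ^+ 2 = 1.
  by have := congr1 (@complex.Re R) uu; rewrite Re_mul_conj.
have x_le : -1 <= x <= 1 by apply/andP; split; nra.
have y2 : 1 - x ^+ 2 = y ^+ 2 by rewrite -xy addrC addKr.
have [y_ge0|y_lt0] := lerP 0 y.
  exists (acos x).
    by rewrite acos_lepi // andbT (lt_le_trans _ (acos_ge0 x_le)) // oppr_lt0 pi_gt0.
  by rewrite /expi acosK ?in_itv // sin_acos // y2 sqrtr_sqr ger0_norm.
exists (- acos x).
  have x_gt : -1 < x.
    have /andP[x_ge _] := x_le; rewrite lt_neqAle x_ge andbT.
    apply: contraTneq y_lt0 => xN1; move: y2.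
    rewrite -xN1 sqrrN expr1n subrr => /esym/eqP; rewrite sqrf_eq0 => /eqP ->.
    by rewrite ltxx.
  have /andP[_ x1] := x_le.
  rewrite ltrN2 acos_ltpi ?x_gt //= (le_trans _ (pi_ge0 R)) // oppr_le0.
  exact: acos_ge0.
rewrite /expi cosN sinN acosK ?in_itv // sin_acos // y2 sqrtr_sqr ltr0_norm //.
by rewrite opprK.
Qed.

Lemma expi_norm (theta : R) : `|expi theta| = 1.
Proof.
have /eqP := expi_conj theta; rewrite -normCK sqrf_eq1 => /orP[/eqP->|/eqP h] //.
by have := normr_ge0 (expi theta); rewrite h oppr_ge0 ler10.
Qed.

Lemma expi_polar (z : C) :
  exists2 theta : R, - pi < theta <= pi & expi theta * z = `|z|.
Proof.
have [->|z_neq0] := eqVneq z 0.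
  by exists 0; rewrite ?mulr0 ?normr0 // oppr_lt0 pi_gt0 pi_ge0.
have [|theta theta_itv thetaE] := expi_surj (u := `|z| / z).
  by rewrite -normCK normrM normrV ?unitfE // normr_id divff ?normr_eq0 ?expr1n.
by exists theta => //; rewrite thetaE divfK.
Qed.

Lemma kippenhahn_diag n (A : 'M[C]_n) (theta : R) :
  exists (P : 'M[C]_n) (d : 'I_n -> R), [/\ P \is unitarymx,
    re_part (expi theta *: A) = hermitian_diag P d &
    kippenhahn_poly A theta = \prod_i ((d i)%:C%:P - 'X)].
Proof.
have [P [d [P_unitary dE]]] := hermitian_diagonalization (re_part_herm (expi theta *: A)).
by exists P, d; split=> //; rewrite /kippenhahn_poly dE det_hermitian_diag.
Qed.

Lemma root_prod_subX (I : finType) (d : I -> C) x :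
  root (\prod_i ((d i)%:P - 'X)) x = [exists i, x == d i].
Proof.
rewrite /root horner_prod; apply/prodf_eq0/existsP => -[j].
  by move=> _; rewrite !hornerE subr_eq0 => dj; exists j; rewrite eq_sym.
by move=> /eqP ->; exists j; rewrite // !hornerE subrr.
Qed.

(** From here on the Kippenhahn polynomial is independent of the angle and its
roots are the numbers [r] and [- r], for [r] in [rs]. *)
Context (n : nat) (A : 'M[C]_n) (rs : seq R)
  (rs_ge0 : forall r, r \in rs -> 0 <= r)
  (kippenhahnE : forall theta,
     kippenhahn_poly A theta = \prod_(r <- rs) ('X^2 - ((r ^+ 2)%:C)%:P)).

Lemma root_concentric theta x :
  root (kippenhahn_poly A theta) x%:C = (`|x| \in rs).
Proof.
rewrite kippenhahnE /root horner_prod prodf_seq_eq0.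
apply/hasP/idP => [[r r_rs] /=|x_rs].
  rewrite !hornerE -rmorphXn -rmorphB fmorph_eq0 subr_eq0 eqf_sqr.
  by case/orP => /eqP ->; rewrite ?normrN ger0_norm ?rs_ge0.
exists `|x| => //=; rewrite !hornerE -rmorphXn -rmorphB fmorph_eq0.
by rewrite real_normK ?num_real // subrr.
Qed.

Lemma kippenhahn_curve_concentric :
  kippenhahn_curve A = [set z | exists2 r, r \in rs & `|z| = r%:C].
Proof.
apply/seteqP; split=> z.
  (* the roots form a finite set, so a separable polynomial vanishes on every
     branch and the tangency equation forces the derivative to be 0 *)
  pose s := undup (rs ++ [seq - r | r <- rs]); pose p := \prod_(x <- s) ('X - x%:P).
  case/(@kippenhahn_curve_point _ _ A p 0) => [theta x|w [ww]].
    rewrite root_concentric mulr0 mul0r addr0 => x_rs; apply/rootP.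
    rewrite root_prod_XsubC mem_undup mem_cat; case: (ger0P x) x_rs => x0 x_rs.
      by rewrite x_rs.
    by apply/orP; right; apply/mapP; exists (- x); rewrite ?opprK.
  rewrite mulr0 !raddf0 !mul0r !addr0 => /rootP p_root /eqP.
  have p_sep : coprimep p p^`().
    by have := separable_prod_XsubC s; rewrite undup_uniq unlock.
  rewrite mulf_eq0 (negbTE (coprimep_root p_sep p_root)) orbF oppr_eq0 => /eqP Im0.
  exists `|complex.Re (w * z)|.
    move: p_root; rewrite root_prod_XsubC mem_undup mem_cat.
    case/orP => [|/mapP [r]] r_rs; first by rewrite ger0_norm ?rs_ge0.
    by move=> ->; rewrite normrN ger0_norm ?rs_ge0.
  have w_norm : `|w| = 1.
    by have [t _ <-] := expi_surj ww; rewrite expi_norm.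
  rewrite -[LHS]mul1r -w_norm -normrM normc_def Im0 expr0n addr0.
  by rewrite sqrtr_sqr.
move=> [r r_rs zr]; have [theta0 theta0_itv theta0E] := expi_polar z.
exists theta0, (fun=> r); rewrite theta0E zr /=; split=> //; last first.
- have zD := is_derive_Re_expi theta0 z.
  have := is_deriveB zD (is_derive_cst r theta0 1).
  rewrite theta0E zr (_ : - complex.Im r%:C - 0 = 0); last first.
    by rewrite /= oppr0 addr0.
  by move=> H; exact: H.
- by rewrite subrr.
- near=> theta; split; last exact: derivable_cst.
  by rewrite root_concentric ger0_norm ?rs_ge0.
Unshelve. all: by end_near.
Qed.

Context (r : R) (r_rs : r \in rs) (r_max : forall r', r' \in rs -> r' <= r).

Lemma numerical_range_sub z : numerical_range A z -> `|z| <= r%:C.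
Proof.
move=> [x [/vnorm_eq1 x1 ->]]; have [theta _ thetaE] := expi_polar (inner (A *m x) x).
have [P [d [P_unitary dE kippE]]] := kippenhahn_diag A theta.
have d_le i : d i <= r.
  apply: le_trans (ler_norm _) (r_max _); rewrite -(root_concentric theta) kippE.
  by rewrite root_prod_subX; apply/existsP; exists i.
have := hermitian_diag_le x P_unitary d_le.
rewrite -dE inner_re_part -scalemxAl innerZl thetaE x1 mulr1.
by rewrite RRe_real // normr_real.
Qed.

(** At a unit eigenvector of the Hermitian part for the eigenvalue [s = r] or
[s = - r], the quadratic form has real part [s] and modulus at most [r], so it
is equal to [s]. *)
Lemma extreme_eigenvector theta (s : R) : `|s| = r ->
  exists x, [/\ inner x x = 1, re_part (expi theta *: A) *m x = s%:C *: x &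
    inner ((expi theta *: A) *m x) x = s%:C].
Proof.
move=> s_r; have [P [d [P_unitary dE kippE]]] := kippenhahn_diag A theta.
have : root (kippenhahn_poly A theta) s%:C by rewrite root_concentric s_r.
rewrite kippE root_prod_subX => /existsP [i /eqP/complexI s_d].
have [x x1 xE] := hermitian_diag_eigenvector d i P_unitary.
exists x; rewrite dE s_d; split=> //; rewrite -s_d.
set v := inner _ _.
have Re_v : complex.Re v = s.
  apply: complexI; rewrite -inner_re_part dE xE innerZl x1 mulr1 s_d //.
have v_le : `|v| <= `|s|%:C.
  rewrite /v -scalemxAl innerZl normrM expi_norm mul1r s_r.
  by apply: numerical_range_sub; exists x; split=> //; apply/vnorm_eq1.
have Im_v : complex.Im v = 0.
  apply/eqP; rewrite -sqrf_eq0 -[_ == 0]andTb.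
  move: v_le; rewrite normc_def lecR Re_v -(sqrtr_sqr s) ler_sqrt ?sqr_ge0 //.
  rewrite gerDl => v_le; rewrite eq_le v_le sqr_ge0 //.
by apply/eqP; rewrite eq_complex Re_v Im_v /= !eqxx.
Qed.

Lemma numerical_range_concentric : numerical_range A = closed_disk 0 r.
Proof.
apply/seteqP; split=> z.
  by move/numerical_range_sub; rewrite /closed_disk /= subr0.
rewrite /closed_disk /= subr0 => z_le.
have [theta _ thetaE] := expi_polar z.
pose B := expi theta *: A; pose s := complex.Re `|z|.
have sE : `|z| = s%:C by rewrite RRe_real // normr_real.
have s_ge0 : 0 <= s by rewrite -lecR -sE normr_ge0.
have s_le : s <= r by rewrite -lecR -sE.
suff [v [v1 vE]] : exists v, inner v v = 1 /\ inner (B *m v) v = s%:C.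
  exists v; split; first exact/vnorm_eq1.
  have w_neq0 : expi theta != 0 by rewrite -normr_eq0 expi_norm oner_eq0.
  by apply: (mulfI w_neq0); rewrite thetaE sE -vE /B -scalemxAl innerZl.
have r_norm : `|r| = r by rewrite ger0_norm ?rs_ge0.
have rN_norm : `|- r| = r by rewrite normrN.
have [x [x1 Hx Bx]] := extreme_eigenvector theta r_norm.
have [y [y1 Hy By]] := extreme_eigenvector theta rN_norm.
have [r0|r_neq0] := eqVneq r 0.
  exists x; split=> //; rewrite Bx r0; congr (_%:C); apply/eqP.
  by rewrite eq_sym eq_le s_ge0 -r0 s_le.
have r_gt0 : 0 < r by rewrite lt_neqAle eq_sym r_neq0 rs_ge0.
have xy0 : inner x y = 0.
  have : inner (re_part B *m x) y = inner x (re_part B *m y).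
    by rewrite inner_adj re_part_herm.
  rewrite Hx Hy innerZl innerZr conjc_real rmorphN mulNr => /eqP.
  by rewrite -addr_eq0 -mulr2n mulrn_eq0 /= mulf_eq0 fmorph_eq0 (negbTE r_neq0) => /eqP.
have yx0 : inner y x = 0 by rewrite innerC xy0 rmorph0.
(* the Hermitian part does not couple the orthogonal eigenvectors *)
have cross : inner (B *m y) x = - (inner (B *m x) y)^*%R.
  have -> : (inner (B *m x) y)^*%R = inner y (B *m x) by rewrite [RHS]innerC.
  apply/eqP; rewrite -addr_eq0; apply/eqP.
  have : inner (re_part B *m y) x = 0 by rewrite Hy innerZl yx0 mulr0.
  rewrite /re_part -scalemxAl innerZl mulmxDl innerDl.
  rewrite [inner (B^t* *m y) x]inner_adj trmxCK.
  by move/eqP; rewrite mulf_eq0 invr_eq0 pnatr_eq0 => /eqP.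
(* a phase of [y] that cancels the remaining skew-Hermitian coupling *)
have [mu mu1 mu_cross] : exists2 mu : C, mu * mu^*%R = 1 &
    mu^*%R * inner (B *m x) y = mu * (inner (B *m x) y)^*%R.
  have [theta' _ theta'E] := expi_polar (inner (B *m x) y).
  exists (expi theta')^*%R; first by rewrite conjCK mulrC expi_conj.
  rewrite conjCK -rmorphM theta'E; apply/esym.
  exact: (conj_Creal (normr_real _)).
(* [al^2 + be^2 = 1] and [al^2 r - be^2 r = s] *)
pose al := Num.sqrt ((1 + s / r) / 2); pose be := Num.sqrt ((1 - s / r) / 2).
have sr_le1 : s / r <= 1 by rewrite ler_pdivrMr ?mul1r.
have sr_ge0 : 0 <= s / r by rewrite divr_ge0 // ltW.
have al2 : al ^+ 2 = (1 + s / r) / 2 by rewrite sqr_sqrtr //; lra.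
have be2 : be ^+ 2 = (1 - s / r) / 2 by rewrite sqr_sqrtr //; lra.
have conj_al : conjc al%:C = al%:C by exact: conjc_real.
have conj_be : conjc (be%:C * mu) = be%:C * mu^*%R.
  by rewrite rmorphM; congr (_ * _); exact: conjc_real.
exists (al%:C *: x + (be%:C * mu) *: y); split.
  rewrite innerDl !innerDr !innerZl !innerZr x1 y1 xy0 yx0 conj_al conj_be.
  transitivity (al%:C ^+ 2 + be%:C ^+ 2 * (mu * mu^*%R)); first by ring.
  rewrite mu1 mulr1 -!rmorphXn -rmorphD al2 be2 -(rmorph1 (real_complex R)).
  by congr (_%:C); field.
rewrite mulmxDr -!scalemxAr innerDl !innerDr !innerZl !innerZr Bx By cross.
rewrite conj_al conj_be.
transitivity (al%:C ^+ 2 * r%:C - be%:C ^+ 2 * r%:C * (mu * mu^*%R)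
  + al%:C * be%:C * (mu^*%R * inner (B *m x) y - mu * (inner (B *m x) y)^*%R)).
  by rewrite rmorphN; ring.
rewrite mu_cross subrr mulr0 addr0 mu1 mulr1 -mulrBl -!rmorphXn -rmorphB -rmorphM.
by rewrite al2 be2; congr (_%:C); field.
Qed.

End ConcentricCircles.

(** * Roots of [phi] *)

Section PhiRoots.
Context {R : realType}.
Local Notation C := R[i].

Lemma has_top_monic n (p : {poly R}) : has_top n 1 p -> p \is monic /\ size p = n.+1.
Proof.
move=> [sp p_n]; have sizeE : size p = n.+1.
  apply/eqP; rewrite eqn_leq sp ltnNge; apply/negP => p_le.
  by move/eqP: p_n; rewrite nth_default // eq_sym oner_eq0.
by rewrite monicE lead_coefE sizeE /= p_n eqxx.
Qed.

Lemma phi_monic (b c e : R) : phi b c e \is monic /\ size (phi b c e) = 4%N.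
Proof.
apply: has_top_monic; rewrite /phi; set k3 := 3 / 4; set k1 := _ / 16; set k0 := _ / 64.
have X2 := has_topZ k3 (@has_topX R 2); have X1 := has_topZ k1 (@has_topX R 1).
have X0 : has_top 0 k0 k0%:P by rewrite /has_top size_polyC_leq1 coefC.
have := has_topD (has_topD (has_topD (@has_topX R 3)
  (has_topN (has_top_lt (m := 2) (n := 3) isT X2)))
  (has_top_lt (m := 1) (n := 3) isT X1))
  (has_topN (has_top_lt (m := 0) (n := 3) isT X0)).
by rewrite oppr0 !addr0 expr1.
Qed.

Lemma phi_comp_monic (b c e : R) :
  phi b c e \Po 'X^2 \is monic /\ size (phi b c e \Po 'X^2) = 7%N.
Proof.
have [phi_mon phi_size] := phi_monic b c e.
have p_monic : phi b c e \Po 'X^2 \is monic.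
  by rewrite monicE lead_coef_comp ?size_polyXn // lead_coefXn expr1n mulr1 -monicE.
split=> //; have := size_comp_poly (phi b c e) 'X^2.
rewrite phi_size size_polyXn => sizeE.
by rewrite -[LHS]prednK ?sizeE // size_poly_gt0 monic_neq0.
Qed.

(** The roots of [phi] are the squares of the eigenvalues of a Hermitian
matrix. *)
Lemma phi_split n (A : 'M[C]_n) (theta : R) (b c e : R) :
  kippenhahn_poly A theta = map_poly (real_complex R) (phi b c e \Po 'X^2) ->
  exists rho1 rho2 rho3 : R, [/\ 0 <= rho1, rho1 <= rho2, rho2 <= rho3 &
    phi b c e = ('X - rho1%:P) * ('X - rho2%:P) * ('X - rho3%:P)].
Proof.
move=> kippE; have [phi_mon phi_size] := phi_monic b c e.
have [P [d [_ _ kipp_prod]]] := kippenhahn_diag A theta.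
have [zs] := closed_field_poly_normal (map_poly (real_complex R) (phi b c e)).
rewrite lead_coef_map (monicP phi_mon) rmorph1 scale1r => zsE.
have zs_sqr z : z \in zs -> exists2 x : R, 0 <= x & z = x%:C.
  move=> z_zs; have : root (kippenhahn_poly A theta) (sqrtC z).
    rewrite kippE map_comp_poly map_polyXn /root horner_comp hornerXn sqrtCK.
    by rewrite zsE -[_ == 0]/(root _ _) root_prod_XsubC.
  rewrite kipp_prod root_prod_subX => /existsP [i /eqP sqrt_z].
  exists (d i ^+ 2); first exact: sqr_ge0.
  by rewrite -[LHS]sqrtCK sqrt_z rmorphXn.
pose xs := sort <=%O [seq complex.Re z | z <- zs].
have phiE : phi b c e = \prod_(x <- xs) ('X - x%:P).
  apply: (map_inj_poly (@complexI R)) => //.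
  rewrite zsE (perm_big _ (permEl (perm_sort _ _))) big_map rmorph_prod /=.
  apply: eq_big_seq => z /zs_sqr [x _ ->].
  by rewrite rmorphB /= map_polyX map_polyC.
have xs_ge0 x : x \in xs -> 0 <= x.
  by rewrite mem_sort => /mapP [z /zs_sqr [y y0 ->] ->].
have : size xs = 3%N.
  by move: phi_size; rewrite phiE size_prod_XsubC => -[].
have := sort_sorted (@le_total _ R) [seq complex.Re z | z <- zs].
rewrite -/xs; case: xs phiE xs_ge0 => [|x1 [|x2 [|x3 [|]]]] //= -> xs_ge0.
move=> /and3P [x12 x23 _] _; exists x1, x2, x3; split=> //.
  by apply: xs_ge0; rewrite mem_head.
by rewrite !big_cons big_nil mulr1 mulrA.
Qed.

(** The coefficient of degree two of [phi] is nonzero, so [phi] is not ['X^3]. *)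
Lemma phi_root_gt0 (b c e rho1 rho2 rho3 : R) :
  0 <= rho1 -> rho1 <= rho2 -> rho2 <= rho3 ->
  phi b c e = ('X - rho1%:P) * ('X - rho2%:P) * ('X - rho3%:P) -> 0 < rho3.
Proof.
move=> r1 r12 r23 phiE; rewrite lt_neqAle (le_trans r1 (le_trans r12 r23)) andbT.
apply/negP => /eqP r3.
have r2_0 : rho2 = 0 by apply/eqP; rewrite eq_le r3 r23 -r3 (le_trans r1).
have r1_0 : rho1 = 0 by apply/eqP; rewrite eq_le r1 andbT -r2_0.
have p1 := congr1 (horner^~ 1) phiE; have pN1 := congr1 (horner^~ (-1)) phiE.
have be_ge0 : 0 <= b ^+ 2 * e ^+ 2 by rewrite mulr_ge0 ?sqr_ge0.
move: p1 pN1; rewrite /phi -r3 r2_0 r1_0 !hornerE /= => p1 pN1; lra.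
Qed.

Lemma circle0_eq0 (r : R) : 0 <= r -> circle 0 r = [set 0] <-> r = 0.
Proof.
move=> r_ge0; split=> [circE|->].
  have : circle 0 r r%:C.
    by rewrite /circle /= subr0 normc_def /= expr0n addr0 sqrtr_sqr ger0_norm.
  by rewrite circE => /complexI.
apply/seteqP; split=> z; rewrite /circle /= subr0.
  by move=> /eqP; rewrite normr_eq0 => /eqP.
by move=> ->; rewrite normr0.
Qed.

End PhiRoots.

(** * Circular components for nilpotent partial isometries of rank three *)

Theorem theorem6p2 (R : realType) (A : 'M[R[i]]_6)
    (b c d e : R) (f g : R[i])
    (A_nilpotent : exists k : nat, A ^+ k = 0)
    (A_rank : \rank A = 3%N)
    (A_pisom : partial_isometry A)
    (b_ge0 : 0 <= b) (c_ge0 : 0 <= c) (d_ge0 : 0 <= d) (e_ge0 : 0 <= e)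
    (c_eq0 : e = 0 -> c = 0)
    (A_equiv : circ_equiv A (canonical_mx b c d e f g 0)) :
  ((exists (a : R[i]) (r : R), 0 < r /\ circle a r `<=` kippenhahn_curve A)
     <-> c%:C * e%:C * g = 0) /\
  (c%:C * e%:C * g = 0 ->
   exists rho1 rho2 rho3 : R,
     let r1 := Num.sqrt rho1 in
     let r2 := Num.sqrt rho2 in
     let r3 := Num.sqrt rho3 in
     [/\ 0 <= rho1 /\ rho1 <= rho2 /\ rho2 <= rho3,
         phi b c e = ('X - rho1%:P) * ('X - rho2%:P) * ('X - rho3%:P),
         kippenhahn_curve A = circle 0 r1 `|` circle 0 r2 `|` circle 0 r3 /\
         (forall theta : R, kippenhahn_poly A theta =
            ('X^2 - ((r1 ^+ 2)%:C)%:P) * ('X^2 - ((r2 ^+ 2)%:C)%:P)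
              * ('X^2 - ((r3 ^+ 2)%:C)%:P)),
         (circle 0 r1 = [set 0] \/ circle 0 r2 = [set 0]
            \/ circle 0 r3 = [set 0]) <-> b * e = 0
       & numerical_range A = closed_disk 0 r3]).
Proof.
have [U [tau [U_unitary B_eq]]] := A_equiv.
have B_rank : \rank (canonical_mx b c d e f g 0) = 3%N by rewrite B_eq mxrank_circ.
have B_pisom : partial_isometry (canonical_mx b c d e f g 0).
  by rewrite B_eq; exact: partial_isometry_circ.
have [dd ff df] := canonical_orthonormal B_rank B_pisom.
pose kappa : R[i] := (c * e / 16)%:C * (expi (- tau) * g).
have kippE theta : kippenhahn_poly A theta = map_poly (real_complex R)
    (phi b c e \Po 'X^2 + complex.Re (expi theta * kappa) *: 'X).
  have := kippenhahn_circ A tau (theta - tau) U_unitary.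
  rewrite subrK -B_eq (kippenhahn_canonical _ dd ff df) => <-.
  congr (map_poly _ (_ + _ *: _)); rewrite /coupling_coef /kappa expiD.
  rewrite [X in _ = complex.Re X]mulrCA [expi theta * (_ * g)]mulrA.
  by case: (expi _ * _ * g) => x y /=; ring.
have kappa_eq0 : kappa = 0 <-> c%:C * e%:C * g = 0.
  have w_neq0 : expi (- tau) != 0 :> R[i] by rewrite -normr_eq0 expi_norm oner_eq0.
  rewrite /kappa rmorphM fmorphV rmorph_nat rmorphM; split=> /eqP.
    rewrite !mulf_eq0 invr_eq0 pnatr_eq0 orbF (negbTE w_neq0) /= => h.
    by apply/eqP; rewrite !mulf_eq0.
  rewrite !mulf_eq0 => h.
  by apply/eqP; rewrite !mulf_eq0 invr_eq0 pnatr_eq0 orbF (negbTE w_neq0).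
have concentric : c%:C * e%:C * g = 0 -> exists rho1 rho2 rho3 : R,
   [/\ 0 <= rho1, rho1 <= rho2 & rho2 <= rho3] /\
   [/\ phi b c e = ('X - rho1%:P) * ('X - rho2%:P) * ('X - rho3%:P) &
    forall theta, kippenhahn_poly A theta =
      \prod_(r <- [:: Num.sqrt rho1; Num.sqrt rho2; Num.sqrt rho3])
        ('X^2 - ((r ^+ 2)%:C)%:P)].
  move=> /kappa_eq0 kappa0.
  have {}kippE theta : kippenhahn_poly A theta =
      map_poly (real_complex R) (phi b c e \Po 'X^2).
    by rewrite kippE kappa0 mulr0 raddf0 scale0r addr0.
  have [rho1 [rho2 [rho3 [r1 r12 r23 phiE]]]] := phi_split (kippE 0).
  have r2 := le_trans r1 r12; have r3 := le_trans r2 r23.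
  exists rho1, rho2, rho3; do 2!split=> //; move=> theta.
  rewrite kippE phiE !big_cons big_nil mulr1 mulrA !sqr_sqrtr //.
  rewrite !comp_polyM !comp_polyB !comp_polyX !comp_polyC !rmorphM !rmorphB /=.
  by rewrite !map_polyXn !map_polyC.
split; last first.
  move=> ceg0.
  have [rho1 [rho2 [rho3 [[r1 r12 r23] [phiE kipp_prod]]]]] := concentric ceg0.
  have rs_ge0 r : r \in [:: Num.sqrt rho1; Num.sqrt rho2; Num.sqrt rho3] -> 0 <= r.
    by rewrite !inE => /or3P [] /eqP ->; exact: sqrtr_ge0.
  exists rho1, rho2, rho3; split=> //.
  - split; last by move=> theta; rewrite kipp_prod !big_cons big_nil mulr1 mulrA.
    rewrite (kippenhahn_curve_concentric rs_ge0 kipp_prod).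
    apply/seteqP; split=> z /=; rewrite /circle /= !subr0.
      case=> r; rewrite !inE => /or3P [] /eqP -> zr; [by left; left|by left; right|].
      by right.
    by move=> [[]|] zr; [exists (Num.sqrt rho1)|exists (Num.sqrt rho2)|
      exists (Num.sqrt rho3)]; rewrite // !inE eqxx ?orbT.
  - have prodE : rho1 * rho2 * rho3 = b ^+ 2 * e ^+ 2 / 64.
      have := congr1 (horner^~ 0) phiE; rewrite /phi !hornerE /= => p0.
      by move: p0; lra.
    have be_eq0 : b * e = 0 <-> rho1 * rho2 * rho3 = 0.
      rewrite prodE; split=> [be0|/eqP].
        by rewrite -exprMn be0 expr0n mul0r.
      by rewrite mulf_eq0 invr_eq0 pnatr_eq0 orbF -exprMn sqrf_eq0 => /eqP.
    have sqrt_eq0 rho : 0 <= rho -> circle 0 (Num.sqrt rho) = [set 0] <-> rho = 0.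
      move=> rho_ge0; rewrite circle0_eq0 ?sqrtr_ge0 //; split=> [/eqP|->].
        by rewrite sqrtr_eq0 => rho_le0; apply/eqP; rewrite eq_le rho_le0.
      by rewrite sqrtr0.
    rewrite be_eq0 !sqrt_eq0 ?(le_trans r1 r12) ?(le_trans (le_trans r1 r12) r23) //.
    split=> [[->|[->|->]]|/eqP]; rewrite ?mulr0 ?mul0r //.
    by rewrite !mulf_eq0 -orbA => /or3P [] /eqP; tauto.
  - apply: (numerical_range_concentric rs_ge0 kipp_prod).
      by rewrite !inE eqxx !orbT.
    move=> r; rewrite !inE => /or3P [] /eqP -> //; apply: ler_wsqrtr => //.
    exact: le_trans r12 r23.
split=> [[a [r [r_gt0 circ_sub]]]|ceg0].
  apply/kappa_eq0; apply: contrapT => /eqP kappa_neq0.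
  have [p_mon p_size] := phi_comp_monic b c e.
  apply: (no_circle _ p_mon p_size kappa_neq0 r_gt0 circ_sub) => theta x.
  rewrite kippE fmorph_root => /rootP; rewrite hornerD hornerZ hornerX.
  by [].
have [rho1 [rho2 [rho3 [[r1 r12 r23] [phiE kipp_prod]]]]] := concentric ceg0.
exists 0, (Num.sqrt rho3); split.
  by rewrite sqrtr_gt0; exact: phi_root_gt0 phiE.
move=> z; rewrite /circle /= subr0 => zr.
rewrite (kippenhahn_curve_concentric _ kipp_prod); last first.
  by move=> r; rewrite !inE => /or3P [] /eqP ->; exact: sqrtr_ge0.
by exists (Num.sqrt rho3); rewrite // !inE eqxx !orbT.
Qed.
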